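(* For $n\ge 1$ let $r_n=\max\{\|M\|_{\mathrm{S}}: M\in\mathbb{M}_n(\mathbb{R}),\ |m_{i,j}|\le 1\text{ for all }i,j\}$, where $\|M\|_{\mathrm{S}}=\max\{\|M\circ C\|: C\in\mathbb{M}_n(\mathbb{C}),\ \|C\|=1\}$. If $n\in\mathbb{N}$ and $p$ is a prime number with $p\le n/2-1$, then $r_n\ge\sqrt{2(p+1)}$. Moreover, $\lim_{n\to\infty} r_n/\sqrt{n}=1$.
   Context: $\|\cdot\|$ is the operator norm (induced by the Euclidean norm) and $\circ$ is the entrywise product of matrices.
   Formalization: The single pair p = 2, n = 6 is excluded from the first claim, since r_6 ≥ √6 is false: r_n = √n would force a real Hadamard matrix of order n, and none of order 6 exists. *)

(* Defs.v *)
From mathcomp Require Import all_boot all_order all_algebra.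
From mathcomp Require Import all_classical all_reals all_analysis.
From mathcomp Require Export complex.

Set Implicit Arguments.
Unset Strict Implicit.
Unset Printing Implicit Defensive.
Import Order.TTheory GRing.Theory Num.Theory.
Import numFieldNormedType.Exports.

Local Open Scope classical_set_scope.
Local Open Scope ring_scope.
Local Open Scope complex_scope.

(* Attained maximum, not a supremum: if A has no greatest element, the value
   is the default 0. *)
Definition setmax (R : realType) (A : set R) : R :=
  xget 0 (A `&` ubound A).

(* [Normc.normc z : R] is the modulus of z as a real number, whereas [`|z|]
   has type R[i]. *)
Definition eucl_norm (R : realType) (n : nat) (x : 'cV[R[i]]_n) : R :=
  Num.sqrt (\sum_(i < n) Normc.normc (x i 0) ^+ 2).

Definition op_norm (R : realType) (n : nat) (A : 'M[R[i]]_n) : R :=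
  sup [set eucl_norm (A *m x) | x in [set x : 'cV[R[i]]_n | eucl_norm x = 1]].

Definition entrywise_mul (S : pzRingType) (m n : nat) (A B : 'M[S]_(m, n)) :
    'M[S]_(m, n) :=
  map2_mx *%R A B.

Definition schur_norm (R : realType) (n : nat) (M : 'M[R]_n) : R :=
  setmax [set op_norm (entrywise_mul (map_mx (real_complex R) M) C)
         | C in [set C : 'M[R[i]]_n | op_norm C = 1]].

(* Meaningful for n >= 1 only: for n = 0 no matrix has norm 1 and the value
   is the default 0. *)
Definition max_schur_norm (R : realType) (n : nat) : R :=
  setmax [set schur_norm M
         | M in [set M : 'M[R]_n | forall i j, `|M i j| <= 1]].

(* Main.v *)
Require Import Defs.
From mathcomp Require Import all_boot all_order all_algebra.
From mathcomp Require Import all_classical all_reals all_analysis.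
From mathcomp Require Import finfield ring lra zify.
Import Order.TTheory GRing.Theory Num.Theory.
Import numFieldNormedType.Exports.
Local Open Scope classical_set_scope.
Local Open Scope ring_scope.

(* Writing c_j for the columns of C, ||(M o C) x|| is at most the sum of the
   |x_j| ||c_j||, hence at most sqrt n ||C|| ||x||, so r_n <= sqrt n.

   If H is a Hadamard matrix of order m and M is a k x k corner of H padded
   with zeros, then ||M|| <= sqrt m and M o M is the all-ones matrix of order k,
   so C = M / sqrt m gives r_n >= k / sqrt m whenever k <= m and k <= n.
   The Paley matrices (order 2 (p + 1), p odd) with k = m settle the first
   claim for p odd; for p = 2, where n >= 7, take m = 8 and k = 7, since
   7 / sqrt 8 > sqrt 6.

   The limit needs no information on gaps between primes: Hadamard orders are
   closed under products, and 2 and 12 = 2 (5 + 1) are Hadamard orders. As 2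
   and 12 are multiplicatively independent, consecutive numbers of the form
   2^a 12^b have ratio tending to 1, so every large n is asymptotic to a
   Hadamard order m <= n, and sqrt m <= r_n <= sqrt n. *)

(** * Quadratic characters and Hadamard matrices *)

Section QuadraticCharacter.
Context {F : finFieldType} {R : realFieldType}.

(** Euler's criterion: for odd q = [#|F|] the exponent is (q - 1) / 2, and this is the quadratic
    character with values in [R]. *)
Definition quad_char (x : F) : R :=
  if x == 0 then 0 else if x ^+ #|F|./2 == 1 then 1 else -1.

Lemma quad_char0 : quad_char 0 = 0.
Proof. by rewrite /quad_char eqxx. Qed.

Lemma quad_char1 : quad_char 1 = 1.
Proof. by rewrite /quad_char oner_eq0 expr1n eqxx. Qed.

Lemma quad_char_sqr (x : F) : quad_char x ^+ 2 = (x != 0)%:R.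
Proof.
rewrite /quad_char; case: eqP => _ /=; first by rewrite expr0n.
by case: ifP => _; rewrite ?sqrrN expr1n.
Qed.

Hypothesis oddF : odd #|F|.

Lemma expf_half_card (x : F) : x != 0 ->
  (x ^+ #|F|./2 == 1) || (x ^+ #|F|./2 == -1).
Proof.
move=> x0; rewrite -sqrf_eq1 -exprM muln2; apply/eqP/(mulfI x0).
rewrite -exprS mulr1 -{2}(expf_card x); congr (_ ^+ _).
by rewrite -[RHS]odd_double_half oddF.
Qed.

Lemma quad_charM (x y : F) : quad_char (x * y) = quad_char x * quad_char y.
Proof.
have [->|x0] := eqVneq x 0; first by rewrite mul0r quad_char0 mul0r.
have [->|y0] := eqVneq y 0; first by rewrite mulr0 quad_char0 mulr0.
rewrite /quad_char mulf_eq0 (negPf x0) (negPf y0) exprMn /=.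
have := expf_half_card _ y0; have := expf_half_card _ x0.
have [-> _ _|nx /= /eqP xE] := eqVneq (x ^+ _) 1; first by rewrite !mul1r.
have [-> _|ny /= /eqP ->] := eqVneq (y ^+ _) 1.
  by rewrite !mulr1 (negPf nx).
by rewrite xE mulrNN mulr1 eqxx mulrNN mulr1.
Qed.

(** Otherwise all q - 1 nonzero elements would be roots of [X^((q-1)/2) - 1], too many for its
    degree. *)
Lemma quad_nonresidue : exists2 a : F, a != 0 & quad_char a = -1.
Proof.
have [/existsP[a /andP[a0 ha]]|/existsPn h] :=
  boolP [exists a : F, (a != 0) && (a ^+ #|F|./2 != 1)].
  by exists a => //; rewrite /quad_char (negPf a0) (negPf ha).
have F1 : (1 < #|F|)%N := finNzRing_gt1 F.
have h0 : (0 < #|F|./2)%N by move: F1 oddF; case: #|F| => [|[|[|]]].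
pose p : {poly F} := 'X^(#|F|./2) - 1%:P.
have sp : size p = #|F|./2.+1 by rewrite /p size_XnsubC.
have p0 : p != 0 by rewrite -size_poly_eq0 sp.
have ap : all (root p) (enum [pred a : F | a != 0]).
  apply/allP => a; rewrite mem_enum inE => a0.
  have := h a; rewrite a0 negbK => /eqP ha.
  by rewrite /root !hornerE ha subrr.
have := max_poly_roots p0 ap (enum_uniq _).
rewrite -cardE sp; have := cardC (pred1 (0 : F)); rewrite card1.
have -> : #|[predC pred1 (0 : F)]| = #|[pred a : F | a != 0]| by apply: eq_card.
(* The root count leaves only q = 2, which [oddF] excludes. *)
have arith q m : (1 + m = q -> m < q./2.+1 -> 1 < q -> ~~ odd q)%N by lia.
by move=> hc hlt; have := arith _ _ hc hlt F1; rewrite oddF.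
Qed.

(** Multiplication by a nonresidue permutes [F] and negates every term. *)
Lemma sum_quad_char : \sum_x quad_char x = 0.
Proof.
have [a a0 qa] := quad_nonresidue.
have : \sum_x quad_char x = - \sum_x quad_char x.
  rewrite {1}(reindex_inj (mulfI a0)) /= -sumrN; apply: eq_bigr => x _.
  by rewrite quad_charM qa mulN1r.
lra.
Qed.

(* Dividing by [quad_char x ^+ 2] turns the summand into [quad_char (1 + c / x)],
   and [1 + c / x] takes every value except 1. *)
Lemma jacobsthal_sum (c : F) : c != 0 ->
  \sum_x quad_char x * quad_char (x + c) = -1.
Proof.
move=> c0; rewrite (bigD1 0) //= quad_char0 mul0r add0r.
rewrite (reindex_onto (fun y => c / (y - 1)) (fun x => 1 + c / x)) /=; last first.
  move=> x x0; rewrite [1 + _]addrC addrK invf_div mulrCA divff ?mulr1 //.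
have := sum_quad_char; rewrite (bigD1 1) //= quad_char1 => /eqP.
rewrite addrC addr_eq0 => /eqP <-; apply: eq_big => [y|y].
  (* As [0^-1 = 0], the value [y = 1] gives [x = 0], which the sum omits. *)
  have [->|y1] := eqVneq y 1; first by rewrite subrr invr0 mulr0 eqxx.
  have y10 : y - 1 != 0 by rewrite subr_eq0.
  rewrite mulf_neq0 ?invr_eq0 //=; apply/eqP.
  by rewrite invf_div mulrCA divff // mulr1 addrCA subrr addr0.
have [->|y1 _] := eqVneq y 1; first by rewrite subrr invr0 mulr0 eqxx.
have y10 : y - 1 != 0 by rewrite subr_eq0.
have -> : c / (y - 1) + c = c / (y - 1) * y by field.
rewrite (quad_charM _ y) mulrA -expr2 quad_char_sqr mulf_neq0 ?invr_eq0 // mul1r.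
by [].
Qed.

End QuadraticCharacter.

Lemma sum_option (V : nmodType) (T : finType) (f : option T -> V) :
  \sum_i f i = f None + \sum_t f (Some t).
Proof.
by rewrite -!big_enum !enumT [Finite.enum in LHS]unlock big_cons big_map.
Qed.

(** * Hadamard matrices, conference matrices and Paley's construction *)

Section Hadamard.
Context {R : realFieldType}.

(** Arbitrary finite index types let Kronecker products and bordered matrices live on [I * J] and
    [option F] without renumbering. *)
Definition hadamard {I : finType} (H : I -> I -> R) : Prop :=
  (forall i j, H i j ^+ 2 = 1) /\
  (forall j k, \sum_i H i j * H i k = #|I|%:R * (j == k)%:R).

Definition hadamard_order (m : nat) : Prop :=
  exists (I : finType) (H : I -> I -> R), #|I| = m /\ hadamard H.

(** Conference matrices, symmetric for [s = 1] and skew for [s = -1]; the sign [s] treats p = 1 and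
    p = 3 mod 4 together. *)
Definition sym_conference {I : finType} (s : R) (S : I -> I -> R) : Prop :=
  [/\ forall i, S i i = 0, forall i j, i != j -> S i j ^+ 2 = 1,
      forall i j, S j i = s * S i j &
      forall j k, \sum_i S i j * S i k = (#|I|%:R - 1) * (j == k)%:R].

(** The Jacobsthal matrix of differences, bordered by a row of ones and a column of
    [quad_char (-1)]. *)
Definition paley_core {F : finFieldType} (x y : option F) : R :=
  match x, y with
  | None, None => 0
  | None, Some _ => 1
  | Some _, None => quad_char (-1 : F)
  | Some a, Some b => quad_char (a - b)
  end.

(** Two distinct inner columns have product 1 + (-1) = 0: the border row gives 1 and
    [jacobsthal_sum] gives -1. An inner column is orthogonal to the border column because character
    sums vanish. *)
Lemma sym_conference_paley (F : finFieldType) : odd #|F| ->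
  sym_conference (quad_char (-1 : F)) (paley_core (F := F)).
Proof.
move=> oddF; have qN1 : quad_char (-1 : F) ^+ 2 = 1 :> R.
  by rewrite quad_char_sqr oppr_eq0 oner_eq0.
have shift (b : F) : \sum_a quad_char (a - b) = 0 :> R.
  rewrite -[RHS](sum_quad_char (F := F)) // [RHS](reindex_inj (addIr (- b))) //.
split.
- by case=> [a|] //=; rewrite subrr quad_char0.
- move=> [a|] [b|] //= ab; rewrite ?expr1n // quad_char_sqr subr_eq0.
  by rewrite (_ : a != b) //; apply: contra ab => /eqP ->.
- move=> [a|] [b|] //=; rewrite ?mulr0 ?mulr1 //.
  by rewrite -quad_charM // mulN1r opprB.
move=> j k; rewrite card_option -natr1 addrK sum_option /=.
case: j k => [b|] [c|] /=.
- have [[->]|bc] := eqVneq (Some b) (Some c).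
    rewrite (bigD1 c) //= subrr quad_char0 mul0r add0r !mulr1.
    rewrite (eq_bigr (fun=> 1)); last first.
      by move=> a ac; rewrite -expr2 quad_char_sqr subr_eq0 ac.
    by rewrite sumr_const cardC1 nat1r prednK // (ltn_trans _ (finNzRing_gt1 F)).
  rewrite mulr0 (reindex_inj (addIr b)) /=.
  rewrite (eq_bigr (fun a => quad_char a * quad_char (a + (b - c)))).
    rewrite jacobsthal_sum ?mulr1 ?subrr // subr_eq0.
    by apply: contra bc => /eqP ->.
  by move=> a _; rewrite addrK addrA.
- by rewrite -mulr_suml shift mul0r mulr0 mulr0 addr0.
- by rewrite -mulr_sumr shift !mulr0 mul0r addr0.
- by rewrite mul0r add0r mulr1 (eq_bigr (fun=> 1)) ?sumr_const.
Qed.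

Lemma hadamard_order1 : hadamard_order 1.
Proof.
exists unit, (fun _ _ => 1); split; first by rewrite card_unit.
split=> [i j|[] []]; first by rewrite expr1n.
by rewrite big_const card_unit /= mulr1 addr0.
Qed.

Lemma hadamard_order2 : hadamard_order 2.
Proof.
exists bool, (fun a b => (-1) ^+ (a && b)); split; first by rewrite card_bool.
split=> [i j|j k]; first by rewrite sqrr_sign.
rewrite big_bool card_bool; case: j k => [] [] /=; ring.
Qed.

(** Kronecker product: the Gram sums factor over the two coordinates. *)
Lemma hadamard_orderM m n :
  hadamard_order m -> hadamard_order n -> hadamard_order (m * n).
Proof.
move=> [I [H [<- [H1 HH]]]] [J [K [<- [K1 KK]]]].
exists (I * J)%type, (fun a b => H a.1 b.1 * K a.2 b.2).
split; first by rewrite card_prod.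
split=> [a b|[j j'] [k k']]; first by rewrite exprMn H1 K1 mulr1.
transitivity ((\sum_i H i j * H i k) * (\sum_i K i j' * K i k')).
  rewrite big_distrlr pair_big /=; apply: eq_bigr => -[i i'] _ /=; ring.
rewrite HH KK card_prod natrM xpair_eqE -mulnb natrM; ring.
Qed.

Lemma hadamard_orderX m e : hadamard_order m -> hadamard_order (m ^ e).
Proof.
move=> hm; elim: e => [|e ihe]; first exact: hadamard_order1.
by rewrite expnS; apply: hadamard_orderM.
Qed.

(* S (x) A + 1 (x) B, where A is the 2 x 2 Hadamard matrix and B is chosen so
   that s A^T B + B^T A = 0; this makes the cross terms of the Gram matrix
   cancel. *)
Lemma hadamard_order_conference (I : finType) (s : R) (S : I -> I -> R) :
  s ^+ 2 = 1 -> sym_conference s S -> hadamard_order (2 * #|I|).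
Proof.
move=> s2 [S0 S1 Ss SS].
pose A (a b : bool) : R := (-1) ^+ (a && b).
(* For [s = 1] this makes A^T B skew; for [s = -1] the choice B = A does it. *)
pose B (a b : bool) : R := if s == 1 then (-1) ^+ (a || b) else A a b.
exists (bool * I)%type, (fun x y => S x.2 y.2 * A x.1 y.1 + (x.2 == y.2)%:R * B x.1 y.1).
split; first by rewrite card_prod card_bool.
split=> [[a i] [b j]|[b j] [c k]] /=.
  have [->|ij] := eqVneq i j.
    rewrite S0 mul0r add0r mul1r /B; case: ifP => _; exact: sqrr_sign.
  by rewrite mul0r addr0 exprMn S1 // mul1r sqrr_sign.
have d (f : I -> R) l : \sum_i (i == l)%:R * f i = f l.
  rewrite (bigD1 l) //= eqxx mul1r big1 ?addr0 // => i il.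
  by rewrite (negPf il) mul0r.
transitivity (\sum_(a : bool) (A a b * A a c * \sum_i S i j * S i k
    + A a b * B a c * S k j + B a b * A a c * S j k + B a b * B a c * (k == j)%:R)).
  rewrite -(pair_bigA _ (fun a i => (S i j * A a b + (i == j)%:R * B a b) *
     (S i k * A a c + (i == k)%:R * B a c))) /=.
  apply: eq_bigr => a _.
  rewrite -(d (S^~ j)) -[S j k](d (S^~ k)) -[(k == j)%:R](d (fun i => (i == j)%:R)).
  rewrite !mulr_sumr -!big_split /=; apply: eq_bigr => i _; ring.
rewrite SS big_bool card_prod card_bool natrM xpair_eqE -mulnb natrM (Ss j k) eq_sym.
have : (s == 1) || (s == -1) by rewrite -sqrf_eq1 s2.
rewrite /B; have [-> _|_ /= /eqP ->] := eqVneq s 1;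
  rewrite /A; case: b c => [] [] /=; ring.
Qed.

Lemma hadamard_order_paley (p : nat) : prime p -> odd p ->
  hadamard_order (2 * p.+1).
Proof.
move=> p_pr p_odd; have cF := card_Fp p_pr.
have oddF : odd #|'F_p| by rewrite cF.
rewrite -cF -card_option.
apply: hadamard_order_conference _ _ _ _ (sym_conference_paley 'F_p oddF).
by rewrite quad_char_sqr oppr_eq0 oner_eq0.
Qed.
End Hadamard.

(** * Products of powers of 2 and 12 *)

(* Pigeonhole on the leading binary digits of the powers of 12. *)
Lemma close_products_2_12 (K : nat) : (0 < K)%N -> exists a b c d : nat,
  (2 ^ a * 12 ^ b < 2 ^ c * 12 ^ d)%N /\
  (K * (2 ^ c * 12 ^ d) <= K.+1 * (2 ^ a * 12 ^ b))%N.
Proof.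
move=> K0; pose t j := trunc_log 2 (12 ^ j).
have tP j : (2 ^ t j <= 12 ^ j < 2 ^ (t j).+1)%N.
  by apply: trunc_log_bounds; rewrite ?expn_gt0.
have t0 j : (0 < 2 ^ t j)%N by rewrite expn_gt0.
(* [12 ^ j / 2 ^ t j] lies in [1, 2), so [b j] takes only the K values from K to 2K - 1, while [j]
   ranges over K + 1 exponents. *)
pose b j := ((K * 12 ^ j) %/ 2 ^ t j)%N.
have bl j : (K <= b j)%N.
  by rewrite leq_divRL // leq_mul2l; case/andP: (tP j) => ->; rewrite orbT.
have bu j : (b j - K < K)%N.
  rewrite ltn_subLR // ltn_divLR // addnn -mul2n mulnAC mulnC ltn_mul2r K0 /=.
  by rewrite -expnS; case/andP: (tP j).
pose f (j : 'I_K.+1) : 'I_K := Ordinal (bu j).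
have /injectivePn[i [j ij fij]] : ~~ injectiveb f.
  by apply/injectiveP => /leq_card; rewrite !card_ord ltnn.
have bij : b i = b j.
  by have := congr1 val fij; rewrite /=; have := bl i; have := bl j; lia.
(* Equality would force [i = j] on comparing exponents of 3, so the two products can be ordered
   strictly. *)
wlog lt : i j ij fij bij / (12 ^ i * 2 ^ t j < 12 ^ j * 2 ^ t i)%N.
  move=> H; have [|gt|] := ltngtP (12 ^ i * 2 ^ t j)%N (12 ^ j * 2 ^ t i)%N.
  - exact: H.
  - by apply: H gt => //; rewrite eq_sym.
  move=> /(congr1 (logn 3)); rewrite !lognM ?expn_gt0 // !lognX.
  rewrite (_ : logn 3 12 = 1)%N // (_ : logn 3 2 = 0)%N // !muln1 !muln0 !addn0.
  by move=> /val_inj eij; rewrite eij eqxx in ij.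
exists (t j), i, (t i), j; rewrite !(mulnC (2 ^ _)%N); split=> //.
(* With the common quotient b >= K, the two scaled powers lie between b / K and (b + 1) / K, so
   their ratio is at most (b + 1) / b <= (K + 1) / K. *)
have lo : (b i * 2 ^ t i <= K * 12 ^ i)%N by apply: leq_trunc_div.
have hi : (K * 12 ^ j < (b i).+1 * 2 ^ t j)%N by rewrite bij ltn_ceil.
have {}lo := leq_mul lo (leqnn (2 ^ t j)).
have {}hi := leq_mul (ltnW hi) (leqnn (2 ^ t i)).
have Kb := bl i; move: lo hi lt Kb K0; clear.
set X := (12 ^ i)%N; set Y := (12 ^ j)%N; set P := (2 ^ t i)%N; set Q := (2 ^ t j)%N.
move: (b i) X Y P Q => B X Y P Q lo hi lt Kb K0.
have h1 : (B * (K * (Y * P)) <= B.+1 * (K * (X * Q)))%N.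
  by apply: leq_trans (_ : B * (B.+1 * Q * P) <= _)%N; nia.
have h2 : (B * (Y * P) <= B.+1 * (X * Q))%N.
  by rewrite -(leq_pmul2l K0); lia.
nia.
Qed.

(** Bernoulli's inequality (1 + 1/U)^e >= 1 + e/U at e = U, cleared of denominators. *)
Lemma double_expn_leq (U V : nat) : (0 < U)%N -> (U < V)%N -> (2 * U ^ U <= V ^ U)%N.
Proof.
move=> U0 UV.
apply: leq_trans (_ : U.+1 ^ U <= _)%N; last by rewrite leq_exp2r.
suff H e : (U ^ e * (U + e) <= U * U.+1 ^ e)%N.
  by rewrite -(leq_pmul2l U0); have := H U; nia.
elim: e => [|e ih]; first by rewrite !expn0 mul1n muln1 addn0.
rewrite !expnS; nia.
Qed.

(** Take U < V in S with ratio at most (K + 1) / K. Replacing the U factors of U^U by V one at a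
    time climbs by small steps past 2 U^U; after scaling by a power of 2 this ladder straddles n,
    and its last rung not above n is the required m. *)
Lemma dense_semigroup_2_12 (S : nat -> Prop) :
  (forall m n, S m -> S n -> S (m * n)%N) -> S 1%N -> S 2%N -> S 12%N ->
  forall K : nat, (0 < K)%N -> exists N : nat, forall n : nat, (N <= n)%N ->
  exists2 m, S m & (m <= n)%N && (K * n < K.+1 * m)%N.
Proof.
move=> SM S1 S2 S12 K K0.
have SX m e : S m -> S (m ^ e)%N.
  by move=> Sm; elim: e => // e ih; rewrite expnS; apply: SM.
have [a [b [c [d [UV UVK]]]]] := close_products_2_12 K K0.
have SU : S (2 ^ a * 12 ^ b)%N by apply: SM; apply: SX.
have SV : S (2 ^ c * 12 ^ d)%N by apply: SM; apply: SX.
move: UV UVK SU SV; set U := (2 ^ a * _)%N; set V := (2 ^ c * _)%N => UV UVK SU SV.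
have U0 : (0 < U)%N by rewrite muln_gt0 !expn_gt0.
exists (U ^ U)%N => n Nn.
have UU0 : (0 < U ^ U)%N by rewrite expn_gt0 U0.
(* Chosen so that 2^e U^U <= n < 2^(e+1) U^U. *)
pose e := trunc_log 2 (n %/ U ^ U).
have nU : (0 < n %/ U ^ U)%N by rewrite divn_gt0.
have /andP[e1 e2] : (2 ^ e <= n %/ U ^ U < 2 ^ e.+1)%N by apply: trunc_log_bounds.
rewrite leq_divRL // in e1; rewrite ltn_divLR // in e2.
pose g l := (U ^ (U - l) * V ^ l * 2 ^ e)%N.
have g0 : (g 0 <= n)%N by rewrite /g subn0 expn0 muln1 mulnC.
have gU : (n < g U)%N.
  apply: leq_trans e2 _; rewrite /g subnn expn0 mul1n expnSr -mulnA mulnC leq_mul2r.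
  by rewrite double_expn_leq ?orbT.
have ex : exists l, (n < g l)%N by exists U.
case: (ex_minnP ex) => -[|l]; first by rewrite ltnNge g0.
move=> gl lmin; have lU : (l < U)%N by apply: lmin.
have lgl : (g l <= n)%N by rewrite leqNgt; apply/negP => /lmin; rewrite ltnn.
exists (g l); first by apply/SM/SX => //; apply/SM; apply/SX.
rewrite lgl /=.
have step : (g l.+1 * U = g l * V)%N.
  by rewrite /g -[(U - l)%N]prednK ?subn_gt0 // -subnS !expnS; ring.
rewrite -(ltn_pmul2r U0); move: gl step UVK; clear -U0 K0.
move: (g l) (g l.+1) => x y ny yx UVK.
apply: leq_trans (_ : K * (y * U) <= _)%N; last by rewrite yx; nia.
nia.
Qed.

(** * Euclidean and operator norms *)

(** Cauchy-Schwarz against the all-ones vector, by expanding the sum of all squared differences. *)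
Lemma sqr_sum_le {R : realFieldType} {I : finType} (a : I -> R) :
  (\sum_i a i) ^+ 2 <= #|I|%:R * \sum_i a i ^+ 2.
Proof.
have cst (c : R) : \sum_(i : I) c = #|I|%:R * c by rewrite sumr_const mulr_natl.
have : 0 <= \sum_i \sum_j (a i - a j) ^+ 2.
  by apply: sumr_ge0 => i _; apply: sumr_ge0 => j _; apply: sqr_ge0.
have -> : \sum_i \sum_j (a i - a j) ^+ 2 =
  2 * (#|I|%:R * \sum_i a i ^+ 2) - 2 * (\sum_i a i) ^+ 2.
  transitivity (\sum_i (#|I|%:R * a i ^+ 2 + \sum_j a j ^+ 2
                  - 2 * (a i * \sum_j a j))).
    apply: eq_bigr => i _; rewrite mulr_sumr mulr_sumr -cst -sumrN -!big_split /=.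
    by apply: eq_bigr => j _; ring.
  rewrite !big_split /= sumrN -!mulr_sumr cst -mulr_suml; ring.
by rewrite -mulrBr pmulr_rge0 // subr_ge0.
Qed.

Section EuclideanNorm.
Context {R : realType}.
Local Notation C := R[i].
Implicit Types z : C.

Lemma normc_sqrE z : Normc.normc z ^+ 2 = complex.Re z ^+ 2 + complex.Im z ^+ 2.
Proof. by case: z => a b /=; rewrite sqr_sqrtr // addr_ge0 ?sqr_ge0. Qed.

Lemma normc_real (r : R) : Normc.normc (real_complex R r) ^+ 2 = r ^+ 2.
Proof. by rewrite normc_sqrE /= expr0n addr0. Qed.

Lemma normc_sum_sqr_le {I : finType} (a : I -> C) :
  Normc.normc (\sum_i a i) ^+ 2 <= #|I|%:R * \sum_i Normc.normc (a i) ^+ 2.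
Proof.
rewrite normc_sqrE !raddf_sum /=.
under [X in _ <= _ * X]eq_bigr do rewrite normc_sqrE.
by rewrite big_split /= mulrDr lerD // sqr_sum_le.
Qed.

Definition sqnorm {n} (x : 'cV[C]_n) : R := \sum_i Normc.normc (x i 0) ^+ 2.

Lemma eucl_normE n (x : 'cV[C]_n) : eucl_norm x = Num.sqrt (sqnorm x).
Proof. by []. Qed.

Lemma sqnorm_ge0 n (x : 'cV[C]_n) : 0 <= sqnorm x.
Proof. by apply: sumr_ge0 => i _; apply: sqr_ge0. Qed.

Lemma eucl_norm_eq1 n (x : 'cV[C]_n) : eucl_norm x = 1 <-> sqnorm x = 1.
Proof.
rewrite eucl_normE; split=> [h|->]; last exact: sqrtr1.
by rewrite -[LHS]sqr_sqrtr ?sqnorm_ge0 // h expr1n.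
Qed.

Lemma sqnormZ n (c : R) (x : 'cV[C]_n) :
  sqnorm (real_complex R c *: x) = c ^+ 2 * sqnorm x.
Proof.
rewrite /sqnorm mulr_sumr; apply: eq_bigr => i _.
by rewrite mxE Normc.normcM exprMn normc_real.
Qed.

Lemma sqnorm_delta n (j : 'I_n) : sqnorm (delta_mx j 0) = 1.
Proof.
rewrite /sqnorm (bigD1 j) //= big1 => [|i ij]; rewrite mxE.
  by rewrite !eqxx Normc.normc1 expr1n addr0.
by rewrite (negPf ij) Normc.normc0 expr0n.
Qed.

(** Cauchy-Schwarz in each row, then a sum by columns; this is the source of the factor sqrt n in
    the upper bound. *)
Lemma sqnorm_mulmx_le n (A : 'M[C]_n) (x : 'cV[C]_n) :
  sqnorm (A *m x) <= n%:R * \sum_j Normc.normc (x j 0) ^+ 2 * sqnorm (col j A).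
Proof.
have -> : \sum_j Normc.normc (x j 0) ^+ 2 * sqnorm (col j A) =
    \sum_i \sum_j Normc.normc (A i j * x j 0) ^+ 2.
  rewrite exchange_big; apply: eq_bigr => j _; rewrite mulr_sumr.
  by apply: eq_bigr => i _; rewrite mxE Normc.normcM exprMn mulrC.
rewrite mulr_sumr; apply: ler_sum => i _; rewrite mxE.
by have := normc_sum_sqr_le (fun j => A i j * x j 0); rewrite card_ord.
Qed.

Section OperatorNorm.
Context {n : nat}.
Hypothesis n_gt0 : (0 < n)%N.
Implicit Types A : 'M[C]_n.

Let unit_image A := [set eucl_norm (A *m x) | x in [set x | eucl_norm x = 1]].

(** Ensures that the [sup] in [op_norm] is a genuine one: [n_gt0] supplies a unit vector, and
    coordinates of modulus at most 1 give the bound. *)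
Lemma has_sup_op_norm A : has_sup (unit_image A).
Proof.
split.
  exists (eucl_norm (A *m delta_mx (Ordinal n_gt0) 0)).
  by exists (delta_mx (Ordinal n_gt0) 0) => //=; apply/eucl_norm_eq1/sqnorm_delta.
exists (Num.sqrt (n%:R * \sum_j sqnorm (col j A))) => _ [x /= /eucl_norm_eq1 x1 <-].
apply: ler_wsqrtr; apply: le_trans (sqnorm_mulmx_le _ A x) _.
rewrite ler_wpM2l //; apply: ler_sum => j _.
rewrite ler_piMl ?sqnorm_ge0 // -x1 /sqnorm (bigD1 j) //= lerDl.
by apply: sumr_ge0 => i _; apply: sqr_ge0.
Qed.

Lemma eucl_norm_le_op_norm A x : sqnorm x = 1 -> eucl_norm (A *m x) <= op_norm A.
Proof.
move=> x1; apply: sup_upper_bound; first exact: has_sup_op_norm.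
by exists x => //; apply/eucl_norm_eq1.
Qed.

Lemma op_norm_ge0 A : 0 <= op_norm A.
Proof.
apply: le_trans (eucl_norm_le_op_norm A _ (sqnorm_delta n (Ordinal n_gt0))).
exact: sqrtr_ge0.
Qed.

Lemma sqnorm_le_op_norm A x : sqnorm x = 1 -> sqnorm (A *m x) <= op_norm A ^+ 2.
Proof.
move=> /(eucl_norm_le_op_norm A); rewrite eucl_normE => h.
rewrite -[leLHS]sqr_sqrtr ?sqnorm_ge0 // lerXn2r ?nnegrE ?sqrtr_ge0 //.
exact: op_norm_ge0.
Qed.

Lemma op_norm_le A c : 0 <= c ->
  (forall x, sqnorm x = 1 -> sqnorm (A *m x) <= c ^+ 2) -> op_norm A <= c.
Proof.
move=> c0 h; apply: ge_sup; first by case: (has_sup_op_norm A).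
move=> _ [x /= /eucl_norm_eq1 x1 <-]; rewrite eucl_normE.
by rewrite -[leRHS]ger0_norm // -sqrtr_sqr ler_wsqrtr ?h.
Qed.

Lemma op_normZ_le A (c : R) : 0 <= c ->
  op_norm (real_complex R c *: A) <= c * op_norm A.
Proof.
move=> c0; apply: op_norm_le; first by rewrite mulr_ge0 ?op_norm_ge0.
move=> x x1; rewrite -scalemxAl sqnormZ exprMn ler_wpM2l ?sqr_ge0 //.
exact: sqnorm_le_op_norm.
Qed.

(** The reverse inequality is [op_normZ_le] for [c^-1] and the scaled matrix. *)
Lemma op_normZ A (c : R) : 0 < c ->
  op_norm (real_complex R c *: A) = c * op_norm A.
Proof.
move=> c0; apply/eqP; rewrite eq_le op_normZ_le ?(ltW c0) //=.
have := op_normZ_le (real_complex R c *: A) c^-1.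
rewrite scalerA -rmorphM /= mulVf ?gt_eqF // scale1r invr_ge0 (ltW c0) => /(_ isT).
by rewrite ler_pdivlMl.
Qed.

End OperatorNorm.
End EuclideanNorm.

(** * Attainment of the maxima *)

Section Continuity.
Context {R : realType} {T : topologicalType}.
Local Notation C := R[i].

Lemma continuous_fsum {I : finType} (f : I -> T -> R) :
  (forall i, continuous (f i)) -> continuous (fun t => \sum_i f i t).
Proof. by move=> fc; apply: continuous_big => //; apply: add_continuous. Qed.

(** Testing real and imaginary parts keeps all the topology in [R]. *)
Definition continuousC (f : T -> C) : Prop :=
  continuous (fun t => complex.Re (f t)) /\ continuous (fun t => complex.Im (f t)).

Lemma continuousC_cst (z : C) : continuousC (fun=> z).
Proof. by split=> t; apply: cvg_cst. Qed.

Lemma continuousC_Complex (a b : T -> R) :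
  continuous a -> continuous b -> continuousC (fun t => Complex (a t) (b t)).
Proof. by []. Qed.

Lemma continuousC_real (a : T -> R) :
  continuous a -> continuousC (fun t => real_complex R (a t)).
Proof. by move=> ac; split=> // t; apply: cvg_cst. Qed.

Lemma continuousC_mul (f g : T -> C) :
  continuousC f -> continuousC g -> continuousC (fun t => f t * g t).
Proof.
move=> [fr fi] [gr gi]; split.
  rewrite (_ : (fun t => _) = fun t => complex.Re (f t) * complex.Re (g t)
      - complex.Im (f t) * complex.Im (g t)).
    by move=> t; apply: cvgB; apply: cvgM; [exact: fr|exact: gr|exact: fi|exact: gi].
  by apply/funext => t; case: (f t) (g t) => a b [c d].
rewrite (_ : (fun t => _) = fun t => complex.Re (f t) * complex.Im (g t)
    + complex.Im (f t) * complex.Re (g t)).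
  by move=> t; apply: cvgD; apply: cvgM; [exact: fr|exact: gi|exact: fi|exact: gr].
by apply/funext => t; case: (f t) (g t) => a b [c d].
Qed.

Lemma continuousC_sum {I : finType} (f : I -> T -> C) :
  (forall i, continuousC (f i)) -> continuousC (fun t => \sum_i f i t).
Proof.
move=> fc; split.
  rewrite (_ : (fun t => _) = fun t => \sum_i complex.Re (f i t)).
    by apply: continuous_fsum => i; case: (fc i).
  by apply/funext => t; rewrite raddf_sum.
rewrite (_ : (fun t => _) = fun t => \sum_i complex.Im (f i t)).
  by apply: continuous_fsum => i; case: (fc i).
by apply/funext => t; rewrite raddf_sum.
Qed.

Lemma continuous_sqnorm n (x : T -> 'cV[C]_n) :
  (forall i, continuousC (fun t => x t i 0)) -> continuous (fun t => sqnorm (x t)).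
Proof.
move=> xc; apply: continuous_fsum => i; case: (xc i) => xr xi.
rewrite (_ : (fun t => _) = fun t => complex.Re (x t i 0) * complex.Re (x t i 0)
    + complex.Im (x t i 0) * complex.Im (x t i 0)).
  by move=> t; apply: cvgD; apply: cvgM; (exact: xr || exact: xi).
by apply/funext => s; rewrite normc_sqrE !expr2.
Qed.

Lemma continuousC_mulmx n (A : T -> 'M[C]_n) (x : T -> 'cV[C]_n) :
  (forall i j, continuousC (fun t => A t i j)) ->
  (forall j, continuousC (fun t => x t j 0)) ->
  forall i, continuousC (fun t => (A t *m x t) i 0).
Proof.
move=> Ac xc i; rewrite (_ : (fun t => _) = fun t => \sum_j A t i j * x t j 0).
  by apply: continuousC_sum => j; apply: continuousC_mul.
by apply/funext => t; rewrite mxE.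
Qed.
End Continuity.

Section SchurMaximum.
Context {R : realType} {n : nat}.
Hypothesis n_gt0 : (0 < n)%N.
Local Notation C := R[i].
Local Notation "M *o A" := (entrywise_mul (map_mx (real_complex R) M) A) (at level 40).

Lemma sqr_ReIm_le_sqnorm (x : 'cV[C]_n) i :
  complex.Re (x i 0) ^+ 2 + complex.Im (x i 0) ^+ 2 <= sqnorm x.
Proof.
rewrite -normc_sqrE /sqnorm (bigD1 i) //= lerDl.
by apply: sumr_ge0 => k _; apply: sqr_ge0.
Qed.

(** The column [A e_j] has norm at most that of [A]; this puts the entries of contractions into the
    box [-1, 1]. *)
Lemma sqr_ReIm_le_op_norm (A : 'M[C]_n) i j :
  complex.Re (A i j) ^+ 2 + complex.Im (A i j) ^+ 2 <= op_norm A ^+ 2.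
Proof.
have := sqnorm_le_op_norm n_gt0 A _ (sqnorm_delta n j); rewrite -colE.
by apply: le_trans; have := sqr_ReIm_le_sqnorm (col j A) i; rewrite mxE.
Qed.

(* A point of the compact product [-1, 1]^(nat * 'I_n * 'I_n) codes a triple
   (M, C, x): layer 0 is M, layers 1 and 2 are the real and imaginary parts of
   C, and the diagonals of layers 3 and 4 those of x. *)
Let point : topologicalType :=
  prod_topology (fun _ : nat * 'I_n * 'I_n => (R : topologicalType)).
Let coord k i j : point -> R := fun f => f (k, i, j).
Let mtx (f : point) : 'M[R]_n := \matrix_(i, j) coord 0%N i j f.
Let ctx (f : point) : 'M[C]_n :=
  \matrix_(i, j) Complex (coord 1%N i j f) (coord 2%N i j f).
Let vec (f : point) : 'cV[C]_n := \col_i Complex (coord 3%N i i f) (coord 4%N i i f).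

(** Compactness: the norm of (M o C) x is maximised jointly over M, C and x, so one extremal point
    serves both nested maxima. The constraint on C is relaxed to norm at most 1. *)
Lemma exists_schur_maximizer : exists (M0 : 'M[R]_n) (C0 : 'M[C]_n),
  [/\ forall i j, `|M0 i j| <= 1, op_norm C0 <= 1 &
   forall (M : 'M[R]_n) (A : 'M[C]_n), (forall i j, `|M i j| <= 1) ->
     op_norm A <= 1 -> op_norm (M *o A) <= op_norm (M0 *o C0)].
Proof.
have coordc k i j : continuous (coord k i j).
  exact: (@proj_continuous _ (fun _ => R : topologicalType) (k, i, j)).
have mc i j : continuousC (fun f => (map_mx (real_complex R) (mtx f)) i j).
  rewrite (_ : (fun f => _) = fun f => real_complex R (coord 0%N i j f)).
    by apply: continuousC_real; exact: coordc.
  by apply/funext => f; rewrite !mxE.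
have cc i j : continuousC (fun f => ctx f i j).
  rewrite (_ : (fun f => _) = fun f => Complex (coord 1%N i j f) (coord 2%N i j f)).
    by apply: continuousC_Complex; exact: coordc.
  by apply/funext => f; rewrite !mxE.
have vc i : continuousC (fun f => vec f i 0).
  rewrite (_ : (fun f => _) = fun f => Complex (coord 3%N i i f) (coord 4%N i i f)).
    by apply: continuousC_Complex; exact: coordc.
  by apply/funext => f; rewrite !mxE.
pose box := [set f : point | forall q, f q \in `[-1, 1]].
have box_compact : compact box.
  have := @tychonoff _ (fun _ : nat * 'I_n * 'I_n => R : topologicalType)
    (fun=> `[-1, 1]%classic) (fun=> @segment_compact _ _ _).
  by congr (compact _); apply/funext => f; apply/propext.
pose unit_vec := [set f : point | sqnorm (vec f) = 1].
(* The norm bound on C as an intersection of closed conditions, one for each unit vector. *)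
pose contr := \bigcap_(y in [set y : 'cV[C]_n | sqnorm y = 1])
  [set f : point | sqnorm (ctx f *m y) <= 1].
pose K := box `&` (unit_vec `&` contr).
pose g f := sqnorm ((mtx f *o ctx f) *m vec f).
have gc : continuous g.
  apply/continuous_sqnorm/continuousC_mulmx => // i j.
  rewrite (_ : (fun f => _) = fun f =>
    (map_mx (real_complex R) (mtx f)) i j * ctx f i j).
    exact: continuousC_mul.
  by apply/funext => f; rewrite /entrywise_mul mxE.
have K_compact : compact K.
  apply: compact_closedI box_compact _.
  apply: closedI.
    apply: (@preimage_closed point R (fun f => sqnorm (vec f)) [set x | x = 1]).
      by apply: in1W; apply: continuous_sqnorm.
    exact: closed_eq.
  apply: closed_bigI => y _.
  apply: (@preimage_closed point R (fun f => sqnorm (ctx f *m y)) [set x | x <= 1]).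
    apply: in1W; apply/continuous_sqnorm/continuousC_mulmx => // j.
    exact: continuousC_cst.
  exact: closed_le.
pose code (M : 'M[R]_n) (A : 'M[C]_n) (x : 'cV[C]_n) : point := fun q =>
  let: (k, i, j) := q in
  match k with
  | 0%N => M i j | 1%N => complex.Re (A i j) | 2%N => complex.Im (A i j)
  | 3%N => complex.Re (x i 0) | 4%N => complex.Im (x i 0) | _ => 0
  end.
have mtx_code M A x : mtx (code M A x) = M by apply/matrixP => i j; rewrite mxE.
have ctx_code M A x : ctx (code M A x) = A.
  by apply/matrixP => i j; rewrite mxE /coord /=; case: (A i j).
have vec_code M A x : vec (code M A x) = x.
  by apply/matrixP => i j; rewrite mxE /coord /= (ord1 j); case: (x i 0).
have sq_itv (a b : R) : a ^+ 2 + b ^+ 2 <= 1 ->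
    (a \in `[-1, 1]) * (b \in `[-1, 1]).
  by move=> ab; split; rewrite in_itv /=; apply/andP; split; nra.
have K_code (M : 'M[R]_n) (A : 'M[C]_n) (x : 'cV[C]_n) :
    (forall i j, `|M i j| <= 1) -> op_norm A <= 1 ->
    sqnorm x = 1 -> K (code M A x).
  move=> M1 A1 x1; have A1sqr : op_norm A ^+ 2 <= 1.
    by rewrite expr_le1 ?op_norm_ge0.
  split; [|split].
  - move=> [[[|[|[|[|[|k]]]]] i] j] /=.
    + by rewrite in_itv /= -ler_norml.
    + by rewrite (sq_itv _ _ (le_trans (sqr_ReIm_le_op_norm A i j) A1sqr)).
    + by rewrite (sq_itv _ _ (le_trans (sqr_ReIm_le_op_norm A i j) A1sqr)).
    + by have := sqr_ReIm_le_sqnorm x i; rewrite x1 => /sq_itv ->.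
    + by have := sqr_ReIm_le_sqnorm x i; rewrite x1 => /sq_itv ->.
    + by rewrite in_itv /=; lra.
  - by rewrite /unit_vec /= vec_code.
  - move=> y /= y1; rewrite ctx_code.
    exact: le_trans (sqnorm_le_op_norm n_gt0 A _ y1) _.
have K_neq0 : K !=set0.
  exists (code 0 0 (delta_mx (Ordinal n_gt0) 0)); apply: K_code.
  - by move=> i j; rewrite mxE normr0.
  - apply: op_norm_le => // x _; rewrite mul0mx expr1n /sqnorm big1 // => i _.
    by rewrite mxE Normc.normc0 expr0n.
  - exact: sqnorm_delta.
have [f fK fmax] := compact_EVT_max K_neq0 K_compact (continuous_subspaceT gc).
move/set_mem: fK => [fbox [fvec fcontr]].
exists (mtx f), (ctx f); split.
- by move=> i j; rewrite mxE ler_norml; have := fbox (0%N, i, j); rewrite in_itv.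
- by apply: op_norm_le => // y y1; rewrite expr1n; apply: fcontr.
move=> M A M1 A1; apply: op_norm_le => // [|x x1]; first exact: op_norm_ge0.
apply: le_trans (sqnorm_le_op_norm n_gt0 _ _ fvec).
have := fmax (code M A x); rewrite /g mtx_code ctx_code vec_code; apply.
exact/mem_set/K_code.
Qed.
End SchurMaximum.

Lemma setmaxE {R : realType} (A : set R) a : A a -> ubound A a -> setmax A = a.
Proof.
move=> Aa ua; have [] := @xgetI _ 0 (A `&` ubound A) a (conj Aa ua).
rewrite -/(setmax A) => Am um; apply/eqP; rewrite eq_le; apply/andP; split.
  exact: ua.
exact: um.
Qed.

(** The default value of [setmax] is 0, so for [a >= 0] the bound holds whether or not the maximum
    is attained. *)
Lemma setmax_le {R : realType} (A : set R) a : 0 <= a -> ubound A a -> setmax A <= a.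
Proof. by rewrite /setmax => a0 ua; case: xgetP => // _ -> []/ua. Qed.

(** * The normalised maximiser and the upper bound sqrt n *)

Section MaxSchurNorm.
Context {R : realType} {n : nat}.
Hypothesis n_gt0 : (0 < n)%N.
Local Notation C := R[i].
Local Notation "M *o A" := (entrywise_mul (map_mx (real_complex R) M) A) (at level 40).

Lemma op_norm_entrywise_mul_le (M : 'M[R]_n) (A : 'M[C]_n) :
  (forall i j, `|M i j| <= 1) -> op_norm (M *o A) <= Num.sqrt n%:R * op_norm A.
Proof.
move=> M1; apply: op_norm_le => // [|x x1].
  by rewrite mulr_ge0 ?sqrtr_ge0 ?op_norm_ge0.
rewrite exprMn sqr_sqrtr //; apply: le_trans (sqnorm_mulmx_le _ _ _) _.
(* The weights |x_j|^2 sum to 1, so it suffices to bound each column of M o A by the norm of A. *)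
rewrite ler_wpM2l // -[leRHS]mul1r -x1 mulr_suml; apply: ler_sum => j _.
rewrite ler_wpM2l ?sqr_ge0 //.
apply: le_trans (sqnorm_le_op_norm n_gt0 A _ (sqnorm_delta n j)).
rewrite -colE; apply: ler_sum => i _; rewrite !mxE Normc.normcM exprMn normc_real.
by rewrite ler_piMl ?sqr_ge0 // -real_normK ?num_real // expr_le1.
Qed.

Lemma op_norm1 : op_norm (1%:M : 'M[C]_n) = 1.
Proof.
apply/eqP; rewrite eq_le op_norm_le //= => [|x x1]; last by rewrite mul1mx x1 expr1n.
have e1 := sqnorm_delta (R := R) n (Ordinal n_gt0).
by have := eucl_norm_le_op_norm n_gt0 1%:M _ e1; rewrite mul1mx eucl_normE e1 sqrtr1.
Qed.

(** The compactness argument yields only norm at most 1 for C; dividing C by its nonzero norm does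
    not lower the value and reaches norm exactly 1. *)
Lemma max_schur_norm_attained : exists (M0 : 'M[R]_n) (C0 : 'M[C]_n),
  [/\ forall i j, `|M0 i j| <= 1, op_norm C0 = 1,
      max_schur_norm R n = op_norm (M0 *o C0) &
   forall (M : 'M[R]_n) (A : 'M[C]_n), (forall i j, `|M i j| <= 1) ->
     op_norm A <= 1 -> op_norm (M *o A) <= op_norm (M0 *o C0)].
Proof.
have [M0 [C1 [M01 C11 maxC1]]] := @exists_schur_maximizer R n n_gt0.
have c_gt0 : 0 < op_norm C1.
  rewrite lt_def op_norm_ge0 // andbT; apply/eqP => c0.
  (* The all-ones matrix with C = I attains 1, whereas [op_norm C1 = 0] would make the maximum 0. *)
  have J1 i j : `|(const_mx 1 : 'M[R]_n) i j| <= 1 by rewrite mxE normr1.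
  have := maxC1 _ 1%:M J1; rewrite op_norm1 => /(_ (lexx 1)).
  have -> : const_mx 1 *o 1%:M = 1%:M :> 'M[C]_n.
    by apply/matrixP => i j; rewrite !mxE mul1r.
  rewrite op_norm1.
  move=> /le_trans /(_ (op_norm_entrywise_mul_le _ C1 M01)).
  by rewrite c0 mulr0 ler10.
pose C0 := real_complex R (op_norm C1)^-1 *: C1.
have C01 : op_norm C0 = 1.
  by rewrite op_normZ ?invr_gt0 // mulVf ?gt_eqF.
have maxC0 (M : 'M[R]_n) (A : 'M[C]_n) : (forall i j, `|M i j| <= 1) ->
     op_norm A <= 1 -> op_norm (M *o A) <= op_norm (M0 *o C0).
  move=> M1 A1; apply: le_trans (maxC1 _ _ M1 A1) _.
  have -> : M0 *o C0 = real_complex R (op_norm C1)^-1 *: (M0 *o C1).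
    by apply/matrixP => i j; rewrite !mxE mulrCA.
  rewrite (op_normZ n_gt0); last by rewrite invr_gt0.
  apply: ler_peMl; first exact: op_norm_ge0.
  by rewrite (invf_ge1 c_gt0); exact: C11.
exists M0, C0; split=> //; apply: setmaxE.
  exists M0 => //=; apply: setmaxE; first by exists C0.
  by move=> _ [A /= A1 <-]; apply: maxC0; rewrite ?A1.
move=> _ [M /= M1 <-]; apply: setmax_le; first exact: op_norm_ge0.
by move=> _ [A /= A1 <-]; apply: maxC0; rewrite ?A1.
Qed.

Lemma max_schur_norm_le : max_schur_norm R n <= Num.sqrt n%:R.
Proof.
have [M0 [C0 [M01 C01 -> _]]] := max_schur_norm_attained.
by apply: le_trans (op_norm_entrywise_mul_le _ _ M01) _; rewrite C01 mulr1.
Qed.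

Lemma op_norm_le_max_schur_norm (M : 'M[R]_n) (A : 'M[C]_n) :
  (forall i j, `|M i j| <= 1) -> op_norm A <= 1 ->
  op_norm (M *o A) <= max_schur_norm R n.
Proof. by have [M0 [C0 [_ _ -> maxC0]]] := max_schur_norm_attained; apply: maxC0. Qed.

End MaxSchurNorm.

(** * The lower bound from corners of Hadamard matrices *)

Section HadamardBound.
Context {R : realType}.
Local Notation C := R[i].

(** Summing over all rows of H gives equality, by orthogonality of the columns; the rows selected
    through [e] contribute only part of these squares. *)
Lemma hadamard_partial_isometry {I J : finType} (H : I -> I -> R) (P : pred J)
    (e : J -> I) (u : J -> R) : hadamard H -> {in P &, injective e} ->
  \sum_(i | P i) (\sum_(j | P j) H (e i) (e j) * u j) ^+ 2 <=
  #|I|%:R * \sum_(j | P j) u j ^+ 2.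
Proof.
move=> [_ HH] e_inj.
pose F a := (\sum_(j | P j) H a (e j) * u j) ^+ 2.
have -> : #|I|%:R * \sum_(j | P j) u j ^+ 2 = \sum_a F a.
  transitivity (\sum_(j | P j) \sum_(l | P l) u j * u l *
      \sum_a H a (e j) * H a (e l)).
    rewrite mulr_sumr; apply: eq_bigr => j Pj; rewrite (bigD1 j) //= HH eqxx.
    rewrite [X in _ = _ + X]big1; first by rewrite /= addr0; ring.
    move=> l /andP[Pl lj]; rewrite HH; case: eqP => [/e_inj jl|_]; last by rewrite !mulr0.
    by rewrite jl ?eqxx in lj.
  under eq_bigr do (under eq_bigr do rewrite mulr_sumr; rewrite exchange_big).
  rewrite exchange_big; apply: eq_bigr => a _; rewrite /F expr2 big_distrlr /=.
  by apply: eq_bigr => j _; apply: eq_bigr => l _; ring.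
have F0 a : 0 <= F a by apply: sqr_ge0.
rewrite (_ : \sum_(i | P i) _ = \sum_(a in (e @: P)%SET) F a); last first.
  exact: (esym (big_imset F e_inj)).
by rewrite [leRHS](bigID (mem (e @: P)%SET)) /= lerDl sumr_ge0.
Qed.

Lemma sqnorm_map_mx n (v : 'cV[R]_n) :
  sqnorm (map_mx (real_complex R) v) = \sum_i v i 0 ^+ 2.
Proof. by apply: eq_bigr => i _; rewrite mxE normc_real. Qed.

(** A real matrix acts separately on real and imaginary parts, which reduces its norm to real
    vectors. *)
Lemma sqnorm_real_mulmx n (M : 'M[R]_n) (x : 'cV[C]_n) :
  sqnorm (map_mx (real_complex R) M *m x) =
  \sum_i ((\sum_j M i j * complex.Re (x j 0)) ^+ 2 +
          (\sum_j M i j * complex.Im (x j 0)) ^+ 2).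
Proof.
apply: eq_bigr => i _; rewrite normc_sqrE mxE !raddf_sum /=.
by congr (_ ^+ 2 + _ ^+ 2); apply: eq_bigr => j _; rewrite mxE;
  case: (x j 0) => a b /=; ring.
Qed.

Lemma hadamard_le_max_schur_norm (m k n : nat) :
  hadamard_order (R := R) m -> (0 < k)%N -> (k <= m)%N -> (k <= n)%N ->
  k%:R / Num.sqrt m%:R <= max_schur_norm R n.
Proof.
move=> [I [H [cI hH]]] k0 km kn; have n0 := leq_trans k0 kn.
have m0 := leq_trans k0 km.
have mR : 0 < m%:R :> R by rewrite ltr0n.
have kR : 0 < k%:R :> R by rewrite ltr0n.
have sm0 : 0 < Num.sqrt (m%:R : R) by rewrite sqrtr_gt0.
have x0 : I by apply: (@enum_val I xpredT); rewrite cI; exact: Ordinal m0.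
pose e (i : 'I_n) := nth x0 (enum I) i.
pose P (i : 'I_n) := (i < k)%N.
have size_enum (i : 'I_n) : i \in P -> (i < size (enum I))%N.
  by rewrite -cardE cI => Pi; exact: leq_trans Pi km.
have e_inj : {in P &, injective e}.
  move=> i j Pi Pj /eqP; rewrite nth_uniq ?enum_uniq ?size_enum //.
  by move/eqP/val_inj.
have cardP (c : R) : \sum_(j | P j) c = k%:R * c.
  by rewrite -(big_ord_widen _ (fun=> c) kn) sumr_const card_ord mulr_natl.
pose M : 'M[R]_n := \matrix_(i, j) if P i && P j then H (e i) (e j) else 0.
have M1 : forall i j, `|M i j| <= 1.
  move=> i j; rewrite mxE; case: ifP => _; last by rewrite normr0.
  by rewrite -(@expr_le1 _ 2) // real_normK ?num_real // hH.1.
pose A := real_complex R (Num.sqrt m%:R)^-1 *: map_mx (real_complex R) M.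
have MuE (u : 'I_n -> R) : forall i,
    \sum_j M i j * u j = if P i then \sum_(j | P j) H (e i) (e j) * u j else 0.
  move=> i; case Pi : (P i); last by rewrite big1 // => j _; rewrite mxE Pi mul0r.
  rewrite [RHS]big_mkcond /=; apply: eq_bigr => j _; rewrite mxE Pi /=.
  by case: (P j); rewrite ?mul0r.
have Mu (u : 'I_n -> R) : \sum_i (\sum_j M i j * u j) ^+ 2 <= m%:R * \sum_j u j ^+ 2.
  have := hadamard_partial_isometry _ _ _ u hH e_inj; rewrite cI => h.
  apply: le_trans (le_trans h _).
    rewrite [leRHS]big_mkcond; apply: ler_sum => i _; rewrite MuE.
    by case: (P i); rewrite ?expr0n.
  rewrite ler_wpM2l // [leLHS]big_mkcond; apply: ler_sum => j _.
  by case: (P j); rewrite ?sqr_ge0.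
have A1 : op_norm A <= 1.
  apply: op_norm_le => // x x1; rewrite -scalemxAl sqnormZ exprVn sqr_sqrtr // expr1n.
  rewrite mulrC ler_pdivrMr // mul1r.
  apply: le_trans (_ : m%:R * sqnorm x <= _); last by rewrite x1 mulr1.
  rewrite sqnorm_real_mulmx /sqnorm.
  under [X in _ <= _ * X]eq_bigr do rewrite normc_sqrE.
  rewrite !big_split mulrDr /=.
  by apply: lerD; apply: Mu.
apply: le_trans (op_norm_le_max_schur_norm n0 _ _ M1 A1).
(* The normalised top eigenvector of the k x k all-ones corner, which stretches it by k. *)
pose v : 'cV[R]_n := \col_i if P i then (Num.sqrt k%:R)^-1 else 0.
have v1 : sqnorm (map_mx (real_complex R) v) = 1.
  rewrite sqnorm_map_mx; under eq_bigr do rewrite mxE (fun_if (fun t => t ^+ 2)) expr0n.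
  by rewrite -big_mkcond cardP exprVn sqr_sqrtr // divff // gt_eqF.
apply: le_trans (eucl_norm_le_op_norm n0 _ _ v1).
have -> : entrywise_mul (map_mx (real_complex R) M) A =
    map_mx (real_complex R) (\matrix_(i, j) (M i j ^+ 2 / Num.sqrt m%:R)).
  by apply/matrixP => i j; rewrite !mxE -!rmorphM /=; congr (_ %:C)%C; ring.
rewrite -map_mxM eucl_normE sqnorm_map_mx.
have -> : \sum_i ((\matrix_(i, j) (M i j ^+ 2 / Num.sqrt m%:R)) *m v) i 0 ^+ 2 =
    \sum_(i | P i) (k%:R / Num.sqrt m%:R / Num.sqrt k%:R) ^+ 2.
  rewrite [RHS]big_mkcond; apply: eq_bigr => i _; rewrite mxE.
  transitivity ((\sum_(j | P j)
    (if P i then (Num.sqrt m%:R)^-1 / Num.sqrt k%:R else 0 : R)) ^+ 2).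
    congr (_ ^+ 2); rewrite [RHS]big_mkcond; apply: eq_bigr => j _; rewrite !mxE.
    case: (P j) => /=; last by rewrite mulr0.
    by case: (P i); rewrite ?hH.1 /=; ring.
  by rewrite cardP; case: (P i); rewrite ?mulr0 ?expr0n // -mulrA.
have -> : \sum_(i | P i) (k%:R / Num.sqrt m%:R / Num.sqrt k%:R) ^+ 2 =
    (k%:R / Num.sqrt m%:R) ^+ 2 :> R.
  rewrite cardP [X in _ * X]exprMn exprVn sqr_sqrtr ?ltW // mulrCA divff ?gt_eqF //.
  by rewrite mulr1.
by rewrite sqrtr_sqr ger0_norm // divr_ge0 // ltW.
Qed.
End HadamardBound.

(** * The theorem *)

Lemma sqrt_hadamard_le_max_schur_norm {R : realType} (m n : nat) :
  hadamard_order (R := R) m -> (0 < m)%N -> (m <= n)%N ->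
  Num.sqrt m%:R <= max_schur_norm R n.
Proof.
move=> hm m0 mn; apply: le_trans (hadamard_le_max_schur_norm _ _ _ hm m0 (leqnn m) mn).
by rewrite ler_pdivlMr ?sqrtr_gt0 ?ltr0n // -expr2 sqr_sqrtr.
Qed.

Lemma max_schur_norm_paley {R : realType} (n p : nat) :
  prime p -> p%:R <= n%:R / 2 - 1 :> R -> ~ (p = 2%N /\ n = 6%N) ->
  Num.sqrt (2 * (p%:R + 1)) <= max_schur_norm R n.
Proof.
move=> p_pr pn np; have {}pn : (2 * p.+1 <= n)%N.
  by rewrite -(ler_nat R) natrM -natr1; lra.
have [p2|p_odd] := even_prime p_pr; last first.
  have h := hadamard_order_paley (R := R) _ p_pr p_odd.
  have := sqrt_hadamard_le_max_schur_norm _ _ h isT pn.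
  by rewrite natrM -(natr1 p).
(* Here 2 (p + 1) = 6 <= n, and n = 6 is the excluded case. *)
have n7 : (7 <= n)%N by move: pn np; rewrite p2 => *; lia.
have h8 : hadamard_order (R := R) 8 by exact: (hadamard_orderX 2 3 hadamard_order2).
apply: le_trans (hadamard_le_max_schur_norm 8 7 n h8 isT isT n7).
(* It remains to see that sqrt 48 <= 7. *)
rewrite p2 ler_pdivlMr ?sqrtr_gt0 // -sqrtrM; last by lra.
rewrite -[leRHS]ger0_norm // -sqrtr_sqr ler_wsqrtr //; lra.
Qed.

Lemma cvg_max_schur_norm {R : realType} :
  (fun n : nat => max_schur_norm R n / Num.sqrt n%:R) @ \oo --> (1 : R).
Proof.
apply/cvgrPdist_le => e e0.
(* K > 1 / e makes K / (K + 1) = 1 - 1 / (K + 1) at least 1 - e. *)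
pose K := (Num.trunc e^-1).+1.
have Ke : 1 - e <= K%:R / K.+1%:R :> R.
  have : e^-1 < K%:R by rewrite truncnS_gt.
  rewrite -(ltr_pM2l e0) mulfV ?gt_eqF // => h.
  by rewrite ler_pdivlMr ?ltr0n // -natr1; nra.
have S12 : hadamard_order (R := R) 12 by exact: (@hadamard_order_paley R 5 isT isT).
have [N NP] := dense_semigroup_2_12 _ (@hadamard_orderM R) hadamard_order1
  hadamard_order2 S12 K isT.
(* The successor guarantees n > 0, so that sqrt n can be divided by. *)
exists N.+1 => // n /= Nn; have n0 : (0 < n)%N by apply: leq_trans Nn.
have [m hm /andP[mn Kmn]] := NP n (ltnW Nn).
have m0 : (0 < m)%N by case: m Kmn {hm mn}; rewrite ?muln0.
have sn0 : 0 < Num.sqrt n%:R :> R by rewrite sqrtr_gt0 ltr0n.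
have n0R : 0 < n%:R :> R by rewrite ltr0n.
have r1 : max_schur_norm R n / Num.sqrt n%:R <= 1.
  by rewrite ler_pdivrMr // mul1r max_schur_norm_le.
have r2 : K%:R / K.+1%:R <= max_schur_norm R n / Num.sqrt n%:R.
  apply: le_trans (_ : Num.sqrt m%:R / Num.sqrt n%:R <= _); last first.
    by rewrite ler_pM2r ?invr_gt0 // sqrt_hadamard_le_max_schur_norm.
  (* As m <= n, the number sqrt m / sqrt n is at most 1, hence at least its square m / n. *)
  rewrite -[leRHS]mulr1; apply: le_trans (_ : m%:R / n%:R <= _).
    rewrite ler_pdivlMr // mulrAC ler_pdivrMr ?ltr0n // -!natrM ler_nat.
    by rewrite (mulnC m) ltnW.
  have -> : m%:R / n%:R = (Num.sqrt m%:R / Num.sqrt n%:R) ^+ 2 :> R.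
    by rewrite expr_div_n !sqr_sqrtr.
  rewrite expr2 ler_wpM2l ?divr_ge0 ?sqrtr_ge0 //.
  by rewrite ler_pdivrMr // mul1r ler_wsqrtr // ler_nat.
by rewrite ger0_norm ?subr_ge0 // lerBlDr addrC -lerBlDr (le_trans Ke r2).
Qed.

(* The pair (p, n) = (2, 6) is excluded: r_n = sqrt n forces a real Hadamard
   matrix of order n, and there is none of order 6, so r_6 < sqrt 6. *)
Theorem theorem6 (R : realType) :
  (forall n p : nat, prime p -> p%:R <= n%:R / 2 - 1 :> R ->
     ~ (p = 2%N /\ n = 6%N) ->
     Num.sqrt (2 * (p%:R + 1)) <= max_schur_norm R n) /\
  (fun n : nat => max_schur_norm R n / Num.sqrt n%:R) @ \oo --> (1 : R).
Proof. by split=> [n p|]; [exact: max_schur_norm_paley|exact: cvg_max_schur_norm]. Qed.
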